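(* Up to isomorphism there is exactly one $3$-e.c. graph that is the point graph of a partial geometry $pg(s,2,2)$ (with $s\ge2$): namely $s=7$ and the graph is the Latin square graph of the Cayley table of the group $\mathbb{Z}_2^3$, i.e. the graph with vertex set $\mathbb{Z}_2^3\times\mathbb{Z}_2^3$ in which distinct vertices $(a,b)$ and $(a',b')$ are adjacent iff $a=a'$ or $b=b'$ or $a+b=a'+b'$. In particular, if the point graph of some $pg(s,2,2)$ is $3$-e.c., then $s=7$ and it is isomorphic to this graph.
   Context: A partial geometry $pg(s,t,\alpha)$ is an incidence structure of points and lines such that any two distinct points lie on at most one common line, every line contains exactly $s+1$ points, every point lies on exactly $t+1$ lines, and for every point $p$ and line $L$ with $p$ not on $L$ there are exactly $\alpha$ lines through $p$ meeting $L$. The point graph has the points as vertices, two distinct points adjacent iff collinear. (A $pg(s,2,2)$ is equivalent to a Latin square of order $s+1$: points are the cells, and lines are the rows, columns and symbol classes.) A graph with vertex set $V$ is $n$-e.c. if for every pair of disjoint subsets $A,B\subseteq V$ with $|A\cup B|=n$ (either may be empty) there is a vertex $z\notin A\cup B$ adjacent to every vertex of $A$ and to no vertex of $B$. *)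

(* Defs.v *)
From HB Require Import structures.
From mathcomp Require Import all_boot all_order all_algebra.
Set Implicit Arguments. Unset Strict Implicit. Unset Printing Implicit Defensive.
Import GRing.Theory.
Local Open Scope ring_scope.

Definition partial_geometry (P L : finType) (I : P -> L -> bool)
    (s t alpha : nat) : Prop :=
  [/\ (forall x y : P, x != y -> #|[set l | I x l && I y l]| <= 1)%N,
      (forall l : L, #|[set x | I x l]| = s.+1),
      (forall x : P, #|[set l | I x l]| = t.+1) &
      (forall (x : P) (l : L), ~~ I x l ->
         #|[set m | I x m && [exists y, I y m && I y l]]| = alpha)].

Definition point_graph (P L : finType) (I : P -> L -> bool) : rel P :=
  fun x y => (x != y) && [exists l, I x l && I y l].

Definition n_ec (V : finType) (adj : rel V) (n : nat) : Prop :=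
  forall A B : {set V}, [disjoint A & B] -> #|A :|: B| = n ->
    exists z : V, [/\ z \notin A :|: B,
                      (forall a, a \in A -> adj z a) &
                      (forall b, b \in B -> ~~ adj z b)].

Definition graph_iso (V W : finType) (adjV : rel V) (adjW : rel W) : Prop :=
  exists f : V -> W, bijective f /\ forall x y, adjW (f x) (f y) = adjV x y.

Definition Z23 := 'rV['F_2]_3.

Definition LSgraph : rel (Z23 * Z23) :=
  fun u v => (u != v) &&
    [|| u.1 == v.1, u.2 == v.2 | u.1 + u.2 == v.1 + v.2].

(* Main.v *)
From HB Require Import structures.
Require Import Defs.
From mathcomp Require Import all_boot all_order all_algebra.
Set Implicit Arguments. Unset Strict Implicit. Unset Printing Implicit Defensive.
Import GRing.Theory.

(** In a pg(s,2,2), parallelism of lines is an equivalence relation with three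
    classes, so the geometry is a 3-net and its points on a line form a loop
    whose Latin square graph is the point graph.  If that graph is 3-e.c.,
    three cells (a,d), (a,b), (c,d) with ab = cd have a common neighbour, and
    it can only be the cell (c,b) with symbol ad: hence ab = cd implies
    ad = cb.  A loop with this property is an elementary abelian 2-group V.
    If |V| = 4, every cell off a row is adjacent to one of any three cells of
    that row.  If |V| > 8, there are independent e1, ..., e4, and the cells
    (0,0), (e1,e2), (e3,e4) have no common neighbour.  So |V| = 8.  Conversely,
    for Z_2^3 the 3-e.c. property is checked by enumeration, after translating
    one of the three given cells to the origin. *)

Local Open Scope ring_scope.

(** * Finite sets, the 3-e.c. property and graph isomorphisms *)

Lemma exists_notin (T : finType) (s : seq T) : (size s < #|T|)%N ->
  exists x, x \notin s.
Proof.
move=> ltsT; apply/existsP; rewrite -negb_forall; apply: contraTN ltsT.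
move=> /forallP sT; rewrite -leqNgt; apply: leq_trans (card_size s).
by apply/subset_leq_card/subsetP => x _; exact: sT.
Qed.

Lemma card3_set (T : finType) (C : {set T}) : #|C| = 3 ->
  exists p q r, [/\ p != q, p != r, q != r & C = [set p; q; r]].
Proof.
rewrite cardE => sC; have := enum_uniq (mem C).
case E: (enum C) sC => [|p [|q [|r [|? ?]]]] //= _.
rewrite !inE negb_or => /andP[/andP[pq pr] /andP[qr _]].
exists p, q, r; split=> //; apply/setP=> x.
by rewrite -mem_enum E !inE orbA.
Qed.

(** The uniqueness half uses 3-e.c. only in this form: a common neighbour ([b] true) or a common
    non-neighbour ([b] false) of three vertices. *)
Lemma n_ec3_const (V : finType) (adj : rel V) (b : bool) p q r :
  n_ec adj 3 -> p != q -> p != r -> q != r ->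
  exists z, [/\ z != p, z != q & z != r] /\
            [/\ adj z p = b, adj z q = b & adj z r = b].
Proof.
move=> ec pq pr qr; set C := [set p; q; r].
have cC : #|C| = 3.
  by rewrite /C -setUA cardsU1 cards2 !inE negb_or pq pr qr.
have [||z [zC zA zB]] := ec (if b then C else set0) (if b then set0 else C).
- by case: b; rewrite ?[[disjoint set0 & _]]disjoint_sym disjoints_subset setC0 subsetT.
- by case: b; rewrite ?setU0 ?set0U.
have adjC x : x \in C -> adj z x = b.
  by case: (b) zA zB => zA zB xC; [apply: zA | apply/negbTE/zB].
exists z; split; last by split; apply: adjC; rewrite !inE eqxx ?orbT.
have: z \notin C by case: (b) zC; rewrite ?setU0 ?set0U.
by rewrite !inE !negb_or -andbA => /and3P[].
Qed.

(** The adjacency pattern to ask for is membership in [A] of the three elements of [A :|: B]. *)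
Lemma n_ec3_intro (V : finType) (adj : rel V) :
  (forall p q r, p != q -> p != r -> q != r -> forall b0 b1 b2 : bool,
     exists z, [/\ z != p, z != q & z != r] /\
               [/\ adj z p = b0, adj z q = b1 & adj z r = b2]) ->
  n_ec adj 3.
Proof.
move=> ec A B dAB cAB.
have [p [q [r [pq pr qr EC]]]] := card3_set cAB.
have [z [[zp zq zr] [ap aq ar]]] :=
  ec p q r pq pr qr (p \in A) (q \in A) (r \in A).
have inC x : x \in A :|: B -> adj z x = (x \in A).
  by rewrite EC !inE -orbA => /or3P[]/eqP->.
exists z; split.
- by rewrite EC !inE !negb_or zp zq zr.
- by move=> a aA; rewrite inC // inE aA.
- move=> b bB; rewrite inC ?inE ?bB ?orbT //.
  by move: dAB; rewrite disjoint_sym disjoints_subset => /subsetP/(_ b bB); rewrite inE.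
Qed.

Lemma graph_iso_trans (U V W : finType) (aU : rel U) (aV : rel V) (aW : rel W) :
  graph_iso aU aV -> graph_iso aV aW -> graph_iso aU aW.
Proof.
move=> [f [bf fE]] [g [bg gE]]; exists (g \o f); split; first exact: bij_comp.
by move=> x y; rewrite /= gE.
Qed.

Lemma graph_iso_sym (U V : finType) (aU : rel U) (aV : rel V) :
  graph_iso aU aV -> graph_iso aV aU.
Proof.
move=> [f [[g fK gK] fE]]; exists g; split; first by exists f.
by move=> x y; rewrite -fE !gK.
Qed.

Lemma n_ec_iso (U V : finType) (aU : rel U) (aV : rel V) n :
  graph_iso aU aV -> n_ec aU n -> n_ec aV n.
Proof.
move=> [f [bf fE]] ec A B dAB cAB.
have inj := bij_inj bf; have [g fK gK] := bf.
have [||z [zU zA zB]] := ec (f @^-1: A) (f @^-1: B).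
- rewrite -setI_eq0 -preimsetI; move: dAB; rewrite -setI_eq0 => /eqP->.
  by rewrite preimset0.
- rewrite -preimsetU -cAB; apply: on_card_preimset; exact: onW_bij.
exists (f z); split.
- by move: zU; rewrite -preimsetU inE.
- by move=> a aA; rewrite -(gK a) fE zA // inE gK.
- by move=> b bB; rewrite -(gK b) fE zB // inE gK.
Qed.

(** * The Latin square graph of Z_2^3 is 3-e.c. *)

(** A copy of [Z23] on which the enumeration evaluates; [enc3] and [dec3] link the two. *)
Definition vec3 : Type := bool * bool * bool.

Definition xor3 (u v : vec3) : vec3 :=
  (u.1.1 (+) v.1.1, u.1.2 (+) v.1.2, u.2 (+) v.2).

Definition is0 (u : vec3) : bool := ~~ [|| u.1.1, u.1.2 | u.2].

Definition vec3s : seq vec3 :=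
  [seq (ab, c) | ab <- [seq (a, b) | a <- [:: true; false], b <- [:: true; false]],
                 c <- [:: true; false]].

Definition pts : seq (vec3 * vec3) := [seq (u, v) | u <- vec3s, v <- vec3s].

Definition xorp (p q : vec3 * vec3) := (xor3 p.1 q.1, xor3 p.2 q.2).

Definition is0p (p : vec3 * vec3) := is0 p.1 && is0 p.2.

(* Adjacency to the origin, for p other than the origin. *)
Definition near0 (p : vec3 * vec3) := [|| is0 p.1, is0 p.2 | is0 (xor3 p.1 p.2)].

(** The three given cells are the origin, [q] and [r]. With nested [if], call-by-value evaluation
    skips the remaining tests once one fails. *)
Definition witness (q r : vec3 * vec3) (b0 b1 b2 : bool) (z : vec3 * vec3) :=
  if is0p z then false else
  if near0 z (+) b0 then false else
  let zq := xorp z q in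
  if is0p zq then false else
  if near0 zq (+) b1 then false else
  let zr := xorp z r in
  if is0p zr then false else ~~ (near0 zr (+) b2).

Definition bools := [:: true; false].

Lemma ec3_checked :
  all (fun q => ~~ is0p q ==> all (fun r => ~~ is0p r ==> (~~ is0p (xorp q r) ==>
    all (fun b0 => all (fun b1 => all (fun b2 =>
      has (witness q r b0 b1 b2) pts) bools) bools) bools)) pts) pts.
Proof. by vm_compute. Qed.

Lemma mem_vec3s u : u \in vec3s. Proof. by case: u => [[[] []] []]. Qed.

Lemma mem_pts p : p \in pts.
Proof. by case: p => u v; apply: allpairs_f; exact: mem_vec3s. Qed.

Lemma mem_bools b : b \in bools. Proof. by case: b. Qed.

Lemma ec3_witness q r b0 b1 b2 :
  ~~ is0p q -> ~~ is0p r -> ~~ is0p (xorp q r) ->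
  exists z, witness q r b0 b1 b2 z.
Proof.
move=> q0 r0 qr0.
have /allP/(_ q (mem_pts _))/implyP/(_ q0) := ec3_checked.
move=> /allP/(_ r (mem_pts _))/implyP/(_ r0)/implyP/(_ qr0).
move=> /allP/(_ b0 (mem_bools _))/allP/(_ b1 (mem_bools _)).
by move=> /allP/(_ b2 (mem_bools _))/hasP[w _ ?]; exists w.
Qed.

Lemma card_Z23 : #|Z23| = 8%N.
Proof. by rewrite card_mx card_Fp. Qed.

Definition ord3 k (h : (k < 3)%N) : 'I_3 := Ordinal h.

Definition enc3 (v : Z23) : vec3 :=
  (v 0 (@ord3 0 isT) != 0, v 0 (@ord3 1 isT) != 0, v 0 (@ord3 2 isT) != 0).

Definition dec3 (w : vec3) : Z23 :=
  \row_i (nth false [:: w.1.1; w.1.2; w.2] i)%:R.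

Lemma enc3K : cancel dec3 enc3.
Proof. by case=> [[[] []] []]; rewrite /enc3 !mxE. Qed.

Lemma F2_neq0D (a b : 'F_2) : (a + b != 0) = (a != 0) (+) (b != 0).
Proof. by case: a => [[|[]]] // ?; case: b => [[|[]]]. Qed.

Lemma F2_oppr (a : 'F_2) : - a = a.
Proof. by apply/val_inj; case: a => [[|[]]]. Qed.

Lemma enc3D u v : enc3 (u + v) = xor3 (enc3 u) (enc3 v).
Proof. by rewrite /enc3 !mxE !F2_neq0D. Qed.

Lemma enc3N u : enc3 (- u) = enc3 u.
Proof. by rewrite /enc3 !mxE !F2_oppr. Qed.

Lemma is0_enc3 u : is0 (enc3 u) = (u == 0).
Proof.
apply/idP/eqP=> [|->]; last by rewrite /is0 /enc3 !mxE !eqxx.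
rewrite /is0 !negb_or !negbK => /and3P[/eqP h0 /eqP h1 /eqP h2].
apply/rowP=> -[[|[|[|//]]] h]; rewrite mxE.
- by rewrite -h0; congr (u 0 _); apply/val_inj.
- by rewrite -h1; congr (u 0 _); apply/val_inj.
- by rewrite -h2; congr (u 0 _); apply/val_inj.
Qed.

Definition encp (p : Z23 * Z23) := (enc3 p.1, enc3 p.2).

Lemma encp_xor p q : xorp (encp p) (encp q) = encp (p - q).
Proof. by rewrite /xorp /encp /= !enc3D !enc3N. Qed.

Lemma is0p_encp p : is0p (encp p) = (p == 0).
Proof. by case: p => u v; rewrite /is0p /= !is0_enc3. Qed.

Lemma near0_encp z p : z != p -> near0 (encp (z - p)) = LSgraph z p.
Proof.
move=> zp; rewrite /LSgraph zp /near0 -enc3D !is0_enc3 /= !subr_eq0.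
by rewrite addrACA -opprD subr_eq0.
Qed.

(** Adjacency depends only on the difference of two cells, so translating by [- p] reduces to the
    enumerated case. *)
Lemma LSgraph_ec3 : n_ec LSgraph 3.
Proof.
apply: n_ec3_intro => p q r pq pr qr b0 b1 b2.
have [|||w] := @ec3_witness (encp (q - p)) (encp (r - p)) b0 b1 b2.
- by rewrite is0p_encp subr_eq0 eq_sym.
- by rewrite is0p_encp subr_eq0 eq_sym.
- by rewrite encp_xor is0p_encp subr_eq0 (inj_eq (addIr _)).
(* Translate the witness back: the vertex sought is [p] plus the decoded [w]. *)
have -> : w = encp (p + (dec3 w.1, dec3 w.2) - p).
  by rewrite addrC addKr /encp /= !enc3K -surjective_pairing.
set z := p + _; rewrite /witness !encp_xor.
have e x : z - p - (x - p) = z - x by rewrite opprB addrA subrK.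
rewrite !e !is0p_encp !subr_eq0.
have [//|zp] := eqVneq z p; rewrite near0_encp //.
case: (LSgraph z p =P b0) => [h0|]; last by case: LSgraph b0 => [] [].
have [|zq] := eqVneq z q; first by case: ifP.
rewrite near0_encp //; have [|zr] := eqVneq z r; first by do ?[case: ifP].
rewrite near0_encp // => h; exists z; split=> //; split=> //; move: h; rewrite h0.
  by case: b0 {h0} => /=; case: b1; case: LSgraph.
by case: b0 {h0} => /=; case: ifP => // _; case: b2; case: (LSgraph z r).
Qed.

(** * The Latin square geometry of an abelian group *)

Definition latin_graph (Q : finType) (op : Q -> Q -> Q) : rel (Q * Q) :=
  fun u v => (u != v) &&
    [|| u.1 == v.1, u.2 == v.2 | op u.1 u.2 == op v.1 v.2].

Section CayleyNet.
Variable V : finZmodType.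

(** Row, column and symbol of a cell; a line is then a class together with the value of its
    coordinate. *)
Definition cayley_coord (k : 'I_3) (p : V * V) : V :=
  match val k with 0 => p.1 | 1 => p.2 | _ => p.1 + p.2 end.

Definition cayley_inc (p : V * V) (l : 'I_3 * V) : bool := cayley_coord l.1 p == l.2.

Lemma cayley_coord_inj i j p q : i != j ->
  cayley_coord i p = cayley_coord i q -> cayley_coord j p = cayley_coord j q -> p = q.
Proof.
case: p q => [a b] [c d].
case: i => [[|[|[|//]]] hi]; case: j => [[|[|[|//]]] hj] //= _;
  rewrite /cayley_coord /=.
- by move=> -> ->.
- by move=> -> /addrI->.
- by move=> -> ->.
- by move=> -> /addIr->.
- by move=> E ca; move: E; rewrite ca => /addrI->.
- by move=> E ca; move: E; rewrite ca => /addIr->.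
Qed.

(** With [cayley_coord_inj], this is the Latin square property: any two of the three coordinates
    determine a cell, and freely. *)
Lemma cayley_coord_surj i j (a b : V) : i != j ->
  exists p, cayley_coord i p = a /\ cayley_coord j p = b.
Proof.
case: i => [[|[|[|//]]] hi]; case: j => [[|[|[|//]]] hj] //= _;
  rewrite /cayley_coord /=.
- by exists (a, b).
- by exists (a, b - a); rewrite /= addrC subrK.
- by exists (b, a).
- by exists (b - a, a); rewrite /= subrK.
- by exists (b, a - b); rewrite /= addrC subrK.
- by exists (a - b, b); rewrite /= subrK.
Qed.

Lemma cayley_partial_geometry s : #|V| = s.+1 -> partial_geometry cayley_inc s 2 2.
Proof.
move=> cV; split.
- move=> x y xy; apply/card_le1_eqP => -[i a] [j b].
  rewrite !inE /cayley_inc /= => /andP[/eqP<- /eqP xyi] /andP[/eqP<- /eqP xyj].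
  have [-> //|ij] := eqVneq i j.
  by rewrite (cayley_coord_inj ij (esym xyi) (esym xyj)) eqxx in xy.
- move=> [i a]; rewrite -cV.
  (* A coordinate of another class parametrizes the points of the line by [V]. *)
  have [j ij] : exists j : 'I_3, i != j.
    by exists (if i == 0 then 1 else 0); case: i => [[|[|[|//]]] hi].
  rewrite -(card_in_imset (f := cayley_coord j)) //.
    rewrite -cardsT; apply: eq_card => b; rewrite in_setT.
    have [p [pa pb]] := cayley_coord_surj a b ij.
    by apply/imsetP; exists p; rewrite // inE /cayley_inc pa /=.
  move=> p q; rewrite !inE /cayley_inc /= => /eqP pa /eqP qa.
  by apply: cayley_coord_inj ij _; rewrite pa qa.
- move=> x; have inj : injective (fun i : 'I_3 => (i, cayley_coord i x)).
    by move=> i j [].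
  rewrite -[RHS](card_ord 3) -(card_codom inj).
  apply: eq_card => -[i a]; rewrite inE /cayley_inc /=; apply/eqP/codomP.
    by move=> <-; exists i.
  by move=> [j [-> ->]].
- move=> x [i a] nx; have inj : injective (fun i : 'I_3 => (i, cayley_coord i x)).
    by move=> j k [].
  (* The lines through [x] that meet the given line are those of the two classes other than [i]. *)
  rewrite -[RHS](_ : #|[set~ i]| = 2); last by rewrite cardsC1 card_ord.
  rewrite -(card_imset _ inj); apply: eq_card => -[j b].
  rewrite inE /=; apply/andP/imsetP => [[/eqP /= <-]|[k]].
    case/existsP=> y /andP[/eqP /= yj yi]; exists j; rewrite // !inE.
    apply: contra nx => /eqP ji; rewrite /cayley_inc /= -ji -yj ji.
    by move: yi.
  rewrite !inE => ki [-> ->]; split; first by rewrite /cayley_inc.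
  have [p [pk pi]] := cayley_coord_surj (cayley_coord k x) a ki.
  by apply/existsP; exists p; rewrite /cayley_inc /= pk pi !eqxx.
Qed.

Lemma cayley_point_graph :
  point_graph cayley_inc =2 latin_graph (+%R : V -> V -> V).
Proof.
move=> u v; congr andb; apply/existsP/or3P.
  move=> [[[[|[|[|//]]] h] a]]; rewrite /cayley_inc /cayley_coord /=.
  - by case/andP=> /eqP-> /eqP->; constructor 1.
  - by case/andP=> /eqP-> /eqP->; constructor 2.
  - by case/andP=> /eqP-> /eqP->; constructor 3.
case=> /eqP e; [exists (inord 0, v.1) | exists (inord 1, v.2) | exists (inord 2, v.1 + v.2)];
  by rewrite /cayley_inc /cayley_coord /= inordK //= e eqxx.
Qed.
End CayleyNet.

(** * Elementary abelian 2-groups *)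

Section ElementaryAbelian.
Variable V : finZmodType.
Hypothesis V2 : forall x : V, x + x = 0.

Let oppV (x : V) : - x = x.
Proof. by apply/eqP; rewrite eq_sym -addr_eq0 V2. Qed.

Let V2K (x y : V) : x + (x + y) = y.
Proof. by rewrite addrA V2 add0r. Qed.

Definition comb3 (e1 e2 e3 : V) (v : Z23) : V :=
  e1 *+ v 0 (@ord3 0 isT) + e2 *+ v 0 (@ord3 1 isT) + e3 *+ v 0 (@ord3 2 isT).

(** Reduction of the multiplier modulo 2 is harmless because [x + x = 0]. *)
Lemma mulrnF2D (x : V) (a b : 'F_2) : x *+ (a + b)%R = x *+ a + x *+ b.
Proof.
have -> : val (a + b) = ((a + b) %% 2)%N by [].
case: a => [[|[]]] // ?; case: b => [[|[]]] //= ?;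
  by rewrite ?addr0 ?add0r // V2.
Qed.

Lemma comb3D e1 e2 e3 : {morph comb3 e1 e2 e3 : u v / u + v}.
Proof.
move=> u v; rewrite /comb3 !mxE !mulrnF2D.
by rewrite [RHS]addrACA; congr (_ + _); rewrite addrACA.
Qed.

Lemma comb3_dec3 e1 e2 e3 (b1 b2 b3 : bool) :
  comb3 e1 e2 e3 (dec3 (b1, b2, b3)) = e1 *+ b1 + e2 *+ b2 + e3 *+ b3.
Proof.
rewrite /comb3 !mxE /=.
by case: b1; case: b2; case: b3.
Qed.

(** The kernel is trivial: each of the seven nonzero coefficient triples would give a relation
    excluded by the hypotheses. *)
Lemma comb3_inj e1 e2 e3 : e1 != 0 -> e2 != 0 -> e2 != e1 ->
  e3 \notin [:: 0; e1; e2; e1 + e2] -> injective (comb3 e1 e2 e3).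
Proof.
move=> e10 e20 e21; rewrite !inE !negb_or => /and4P[e30 e31 e32 e312] u v E.
apply/eqP; rewrite -subr_eq0 -is0_enc3; set w := u - v.
have: comb3 e1 e2 e3 w = 0.
  have: comb3 e1 e2 e3 (w + v) = comb3 e1 e2 e3 (0 + v).
    by rewrite /w subrK add0r.
  rewrite !comb3D => /addIr->; rewrite /comb3 !mxE /=.
  by rewrite !mulr0n !addr0.
have eqx (x y : V) : x + y = 0 -> x = y by move/eqP; rewrite addr_eq0 oppV => /eqP.
have F2 (a : 'F_2) : a = (a != 0)%:R by apply/val_inj; case: a => [[|[]]].
rewrite /comb3 /enc3 /is0 /=.
move: (F2 (w 0 (@ord3 0 isT))) (F2 (w 0 (@ord3 1 isT))) (F2 (w 0 (@ord3 2 isT))).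
case: eqP => _ ->; case: eqP => _ ->; case: eqP => _ -> //=;
  rewrite ?mulr1n ?mulr0n ?addr0 ?add0r => h; move: e10 e20 e21 e30 e31 e32 e312;
  try (by rewrite h eqxx); try (by rewrite (eqx _ _ h) eqxx).
Qed.

Hypothesis ec3 : n_ec (latin_graph (+%R : V -> V -> V)) 3.
Hypothesis V_gt2 : (2 < #|V|)%N.

Lemma Z23_iso : exists g : Z23 -> V, bijective g /\ {morph g : u v / u + v}.
Proof.
have [e1] := @exists_notin V [:: 0] (ltnW V_gt2); rewrite !inE => e10.
have [e2] := @exists_notin V [:: 0; e1] V_gt2.
rewrite !inE negb_or => /andP[e20 e21].
have [e3 e3n] : exists e3 : V, e3 \notin [:: 0; e1; e2; e1 + e2].
  have [/existsP //|] := boolP [exists x : V, x \notin [:: 0; e1; e2; e1 + e2]].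
  rewrite negb_exists => /forallP V4.
  (* If [V] is just these four elements, the column and the symbol of a common non-neighbour both
     avoid 0, [e1], [e2]. Both are [e1 + e2], so its row is 0, a contradiction. *)
  have [|||z [[zp zq zr] [z1 z2 z3]]] := @n_ec3_const _ _ false (0, 0) (0, e1) (0, e2) ec3.
  - by rewrite xpair_eqE eqxx eq_sym.
  - by rewrite xpair_eqE eqxx eq_sym.
  - by rewrite xpair_eqE eqxx eq_sym.
  move: z1 z2 z3; rewrite /latin_graph zp zq zr /= => /negbT z1 /negbT z2 /negbT z3.
  move: z1 z2 z3; rewrite !negb_or !add0r => /and3P[u0 v0 w0] /and3P[_ v1 w1] /and3P[_ v2 w2].
  move: (V4 z.2) (V4 (z.1 + z.2)); rewrite !negbK !inE.
  rewrite (negPf v0) (negPf v1) (negPf v2) (negPf w0) (negPf w1) (negPf w2) /=.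
  move=> /eqP-> /eqP; rewrite -[RHS]add0r => /addIr z0.
  by rewrite z0 eqxx in u0.
have inj := comb3_inj e10 e20 e21 e3n; exists (comb3 e1 e2 e3); split; last exact: comb3D.
(* Either [comb3] is onto, hence the isomorphism sought, or there is a fourth independent element
   [e4]. *)
have [/existsP[e4 e4n]|] := boolP [exists x, x \notin codom (comb3 e1 e2 e3)]; last first.
  rewrite negb_exists => /forallP onto.
  have h x : exists u, comb3 e1 e2 e3 u == x.
    have /codomP[u ->] : x \in codom (comb3 e1 e2 e3) by rewrite -[_ \in _]negbK.
    by exists u.
  exists (fun x => xchoose (h x)) => [u|x]; last exact/eqP/(xchooseP (h x)).
  by apply: inj; apply/eqP/(xchooseP (h _)).
have n4 (b1 b2 b3 : bool) : e4 != e1 *+ b1 + e2 *+ b2 + e3 *+ b3.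
  apply: contraNneq e4n => ->; rewrite -(comb3_dec3 e1 e2 e3 b1 b2 b3).
  exact: codom_f.
have e40 : e4 != 0 by have := n4 false false false; rewrite !mulr0n !addr0.
have e41 : e4 != e1 by have := n4 true false false; rewrite !mulr0n !addr0.
have e42 : e4 != e2 by have := n4 false true false; rewrite !mulr0n addr0 add0r.
have e43 : e4 != e3 by have := n4 false false true; rewrite !mulr0n !add0r.
have e412 : e4 != e1 + e2 by have := n4 true true false; rewrite !mulr0n addr0.
have e413 : e4 != e1 + e3 by have := n4 true false true; rewrite !mulr0n addr0.
have e423 : e4 != e2 + e3 by have := n4 false true true; rewrite !mulr0n add0r.
have e4123 : e4 != e1 + e2 + e3 by have := n4 true true true.
move: e3n; rewrite !inE !negb_or => /and4P[e30 e31 e32 e312].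
have mv (x y z : V) : x = y + z -> z = x + y by move=> ->; rewrite addrC V2K.
have eqx (x y : V) : x + y = 0 -> x = y by move/eqP; rewrite addr_eq0 oppV => /eqP.
have [|||z [[_ _ _] [z1 z2 z3]]] := @n_ec3_const _ _ true (0, 0) (e1, e2) (e3, e4) ec3.
- by rewrite xpair_eqE eq_sym (negPf e10).
- by rewrite xpair_eqE eq_sym (negPf e30).
- by rewrite xpair_eqE eq_sym (negPf e31).
have {}z1 := andP z1; have {}z2 := andP z2; have {}z3 := andP z3.
case: z z1 z2 z3 => u v /= [_ z1] [_ z2] [_ z3].
(* The common neighbour shares row, column or symbol with (0,0). In each case two choices remain for
   meeting each of the other cells, and every combination is a linear relation among the [e1], ...,
   [e4]. *)
case/or3P: z1 => /eqP z1.
- rewrite z1 in z2 z3; rewrite !add0r ![0 == _]eq_sym (negPf e10) (negPf e30) /= in z2 z3.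
  case/orP: z2 => /eqP z2; case/orP: z3 => /eqP z3; rewrite z2 in z3.
  + by rewrite z3 eqxx in e42.
  + by rewrite (mv _ _ _ z3) eqxx in e423.
  + by rewrite z3 eqxx in e412.
  + by rewrite (mv _ _ _ z3) eqxx in e4123.
- rewrite z1 in z2 z3; rewrite !addr0 ![0 == _]eq_sym (negPf e20) (negPf e40) /= in z2 z3.
  case/orP: z2 => /eqP z2; case/orP: z3 => /eqP z3; rewrite z2 in z3.
  + by rewrite z3 eqxx in e31.
  + by rewrite (mv _ _ _ z3) eqxx in e413.
  + by rewrite z3 eqxx in e312.
  + by rewrite (mv _ _ _ z3) eqxx in e4123.
- rewrite addr0 in z1; have uv := eqx _ _ z1; rewrite -uv V2 in z2 z3.
  have h12 : (0 == e1 + e2) = false.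
    by apply: contraNF e21 => /eqP/esym/eqx->.
  have h34 : (0 == e3 + e4) = false.
    by apply: contraNF e43 => /eqP/esym/eqx->.
  rewrite h12 h34 !orbF in z2 z3.
  case/orP: z2 => /eqP z2; case/orP: z3 => /eqP z3; rewrite z2 in z3.
  + by rewrite z3 eqxx in e31.
  + by rewrite z3 eqxx in e41.
  + by rewrite z3 eqxx in e32.
  + by rewrite z3 eqxx in e42.
Qed.
End ElementaryAbelian.

(** * Loops whose Latin square graph is 3-e.c *)

Section Loop.
Variables (Q : finType) (op : Q -> Q -> Q) (e : Q).
Hypothesis ope : right_id e op.
Hypothesis eop : left_id e op.
Hypothesis opI : right_injective op.
Hypothesis Iop : left_injective op.
Hypothesis ec3 : n_ec (latin_graph op) 3.

(** A common neighbour of (a,d), (a,b), (c,d) lying in row [a] or column [d] would be one of these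
    cells. So it has symbol [op a d], which forces column [b] and then row [c]. *)
Lemma loop_swap a b c d : op a b = op c d -> op a d = op c b.
Proof.
move=> E; have [ac|ac] := eqVneq a c.
  by move: E; rewrite -ac => /opI->.
have bd : b != d by apply: contraNneq ac => bd; move: E; rewrite bd => /Iop->.
have [|||[u v] [[z1 z2 z3]]] :=
    @n_ec3_const _ _ true (a, d) (a, b) (c, d) ec3.
- by rewrite xpair_eqE eqxx eq_sym.
- by rewrite xpair_eqE (negPf ac).
- by rewrite xpair_eqE (negPf ac).
rewrite /latin_graph z1 z2 z3 /= -E => -[h1 h2 h3].
move: z1 z2 z3; rewrite !xpair_eqE.
case: (eqVneq u a) h1 h2 h3 => [->|ua].
  rewrite (negPf ac) !(inj_eq (@opI a)) /= => _ _.
  by case/orP=> ->.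
case: (eqVneq v d) => [->|vd] /=.
  rewrite eq_sym (negPf bd) E (inj_eq (@Iop d)) /= => _ /eqP->.
  by rewrite eqxx.
move=> /eqP uv /orP[/eqP vb|/eqP uv']; last first.
  by move: bd; rewrite -(inj_eq (@opI a)) -uv' uv eqxx.
rewrite vb (inj_eq (@Iop b)) (negPf ua) orbF => /eqP uc.
by rewrite -uv uc vb.
Qed.

Lemma loopxx x : op x x = e.
Proof. by have /loop_swap := etrans (eop x) (esym (ope x)); rewrite ope. Qed.

Lemma loopK y : involutive (op^~ y).
Proof. by move=> x; have /loop_swap := ope (op x y); rewrite ope. Qed.

Lemma loopC : commutative op.
Proof.
have opK x y : op x (op x y) = y.
  by have /loop_swap := esym (eop (op x y)); rewrite eop.
(* Writing z for xy, [loopK] gives zy = x, so zx = z(zy) = y; multiplying by x on the right gives z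
   = yx. *)
move=> x y; have zx : op (op x y) x = y.
  by rewrite -[RHS](opK (op x y)); congr op; rewrite loopK.
by rewrite -[in RHS]zx; apply/esym/(loopK x).
Qed.

Lemma loopA : associative op.
Proof.
move=> x y z; set w := op (op x y) z.
have wz : op w z = op x y by rewrite /w loopK.
(* The swap yields zy = xw, whence x(yz) = x(xw) = w. *)
have /loop_swap : op z w = op x y by rewrite loopC.
move=> E; rewrite (loopC y) E (loopC x w) loopC.
exact: loopK.
Qed.

Lemma loop_Z23_iso : (2 < #|Q|)%N ->
  #|Q| = 8 /\ graph_iso LSgraph (latin_graph op).
Proof.
move=> Q2.
(* By [loopxx] the opposite is the identity map. *)
pose m := GRing.isZmodule.Build Q loopA loopC eop loopxx.
pose V : finZmodType := HB.pack Q m.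
have bid : bijective (id : Q -> V) by exists id.
have isoV : graph_iso (latin_graph op) (latin_graph (+%R : V -> V -> V)).
  by exists id; split; [exists id | move=> [a b] [c d]].
have [|g [bg gD]] := @Z23_iso V loopxx (n_ec_iso isoV ec3).
  by rewrite -(bij_eq_card bid).
split; first by rewrite (bij_eq_card bid) -(bij_eq_card bg) card_Z23.
apply: graph_iso_trans (graph_iso_sym isoV).
exists (fun p => (g p.1, g p.2)); split.
  case: bg => h gK hK; exists (fun p => (h p.1, h p.2)) => -[a b] /=;
  by rewrite ?gK ?hK.
move=> [a b] [c d]; rewrite /latin_graph /LSgraph /= !xpair_eqE -!gD.
by rewrite !(inj_eq (bij_inj bg)).
Qed.
End Loop.

(** * Coordinatization of 3-nets *)

Section Net.
Variables (P : finType) (L : eqType) (f0 f1 f2 : P -> L) (o : P).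

(** The maps [f] and [g] send a point to its line in two parallel classes; lines of different
    classes meet in exactly one point. *)
Definition net_pair (f g : P -> L) : Prop :=
  (forall p q, f p = f q -> g p = g q -> p = q) /\
  (forall p q, exists r, f r = f p /\ g r = g q).

Definition net_graph : rel P := fun x y =>
  (x != y) && [|| f0 x == f0 y, f1 x == f1 y | f2 x == f2 y].

(** The intersection of the [f]-line of [p] with the [g]-line of [q]; the default [p] is never
    returned for a [net_pair]. *)
Definition cross (f g : P -> L) p q : P :=
  odflt p [pick r | (f r == f p) && (g r == g q)].

Lemma crossP f g p q : net_pair f g ->
  f (cross f g p q) = f p /\ g (cross f g p q) = g q.
Proof.
move=> [_ /(_ p q)[r [fr gr]]]; rewrite /cross.
by case: pickP => [x /andP[/eqP ? /eqP ?] // | /(_ r)]; rewrite fr gr !eqxx.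
Qed.

Hypotheses (n01 : net_pair f0 f1) (n12 : net_pair f1 f2) (n02 : net_pair f0 f2).
Let n21 : net_pair f2 f1.
Proof.
by case: n12 => i s; split=> p q; [move=> *; exact: i | have [r []] := s q p; exists r].
Qed.

(** The [f1]-line of [o] carries the loop, with unit [o]. Rows, columns and symbols are the [f1]-,
    [f2]- and [f0]-lines, labelled by [coord1], [coord2] and [coord0]. *)
Definition axis := {p : P | f1 p == f1 o}.

Definition axis0 : axis := Sub o (eqxx (f1 o)).

Lemma coord0_subproof p : f1 (cross f0 f1 p o) == f1 o.
Proof. by have [_ ->] := crossP p o n01. Qed.
Definition coord0 p : axis := Sub (cross f0 f1 p o) (coord0_subproof p).

Lemma coord2_subproof p : f1 (cross f2 f1 p o) == f1 o.
Proof. by have [_ ->] := crossP p o n21. Qed.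
Definition coord2 p : axis := Sub (cross f2 f1 p o) (coord2_subproof p).

(** An [f1]-line is parallel to the axis, so it is labelled through its point on the [f2]-line of
    [o]. On that line [coord1] and [coord0] thus agree, which makes [o] a right unit. *)
Definition coord1 p : axis := coord0 (cross f1 f2 p o).

Lemma coord0E p : f0 (val (coord0 p)) = f0 p.
Proof. by have [] := crossP p o n01. Qed.

Lemma coord2E p : f2 (val (coord2 p)) = f2 p.
Proof. by have [] := crossP p o n21. Qed.

Lemma axis_eq0 (x y : axis) : f0 (val x) = f0 (val y) -> x = y.
Proof.
move=> h; apply: val_inj; case: n01 => i _; apply: i h _.
by rewrite (eqP (valP x)) (eqP (valP y)).
Qed.

Lemma axis_eq2 (x y : axis) : f2 (val x) = f2 (val y) -> x = y.
Proof.
move=> h; apply: val_inj; case: n21 => i _; apply: i h _.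
by rewrite (eqP (valP x)) (eqP (valP y)).
Qed.

Lemma eq_coord0 p q : (coord0 p == coord0 q) = (f0 p == f0 q).
Proof.
by apply/eqP/eqP=> [h|h]; [rewrite -coord0E h coord0E | apply: axis_eq0; rewrite !coord0E].
Qed.

Lemma eq_coord2 p q : (coord2 p == coord2 q) = (f2 p == f2 q).
Proof.
by apply/eqP/eqP=> [h|h]; [rewrite -coord2E h coord2E | apply: axis_eq2; rewrite !coord2E].
Qed.

Lemma eq_coord1 p q : (coord1 p == coord1 q) = (f1 p == f1 q).
Proof.
rewrite /coord1 eq_coord0.
have [p1 p2] := crossP p o n12; have [q1 q2] := crossP q o n12.
apply/eqP/eqP=> h.
  by rewrite -p1 -q1; congr f1; case: n02 => i _; apply: i; rewrite ?p2 ?q2.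
by congr f0; case: n12 => i _; apply: i; rewrite ?p1 ?p2 ?q1 ?q2.
Qed.

Definition of_coords (x y : axis) : P := cross f1 f2 (cross f0 f2 (val x) o) (val y).

Definition axis_op (x y : axis) : axis := coord0 (of_coords x y).

Lemma of_coordsK x y : coord1 (of_coords x y) = x /\ coord2 (of_coords x y) = y.
Proof.
have [h1 h2] := crossP (cross f0 f2 (val x) o) (val y) n12.
have [k0 k2] := crossP (val x) o n02.
split; last by apply: axis_eq2; rewrite coord2E.
apply: axis_eq0; rewrite /coord1 coord0E -k0; congr f0.
have [m1 m2] := crossP (of_coords x y) o n12.
by case: n12 => i _; apply: i; rewrite ?m1 ?m2 ?k2.
Qed.

Lemma coordsK p : of_coords (coord1 p) (coord2 p) = p.
Proof.
have [h1 h2] := of_coordsK (coord1 p) (coord2 p).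
by case: n12 => i _; apply: i; apply/eqP; rewrite -?eq_coord1 -?eq_coord2 ?h1 ?h2.
Qed.

Lemma axis_opI : right_injective axis_op.
Proof.
move=> x y y' /eqP; rewrite eq_coord0 => /eqP h.
have [a b] := of_coordsK x y; have [a' b'] := of_coordsK x y'.
rewrite -b -b'; congr coord2; case: n01 => i _; apply: i h _.
by apply/eqP; rewrite -eq_coord1 a a'.
Qed.

Lemma axis_Iop : left_injective axis_op.
Proof.
move=> y x x' /eqP; rewrite eq_coord0 => /eqP h.
have [a b] := of_coordsK x y; have [a' b'] := of_coordsK x' y.
rewrite -a -a'; congr coord1; case: n02 => i _; apply: i h _.
by apply/eqP; rewrite -eq_coord2 b b'.
Qed.

Lemma axis_id_r : right_id axis0 axis_op.
Proof.
move=> x; have [a b] := of_coordsK x axis0; apply: axis_eq0.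
rewrite -{2}a /coord1 !coord0E; congr f0.
have [m1 m2] := crossP (of_coords x axis0) o n12.
case: n12 => i _; apply: i; rewrite ?m1 ?m2 //.
by rewrite -coord2E b.
Qed.

(** The cells of row [axis0] are the points of the axis, where [coord0] and [coord2] agree. *)
Lemma axis_id_l : left_id axis0 axis_op.
Proof.
move=> y; have [a b] := of_coordsK axis0 y; apply: axis_eq0.
rewrite coord0E; congr f0; case: n12 => i _; apply: i; last by rewrite -coord2E b.
rewrite (eqP (valP y)); apply/eqP; rewrite -eq_coord1 a; apply/eqP.
apply: axis_eq0; rewrite coord0E; congr f0.
have [m1 m2] := crossP o o n12.
by case: n12 => i _; apply: i.
Qed.

Lemma net_latin_iso : graph_iso net_graph (latin_graph axis_op).
Proof.
have bij : bijective (fun p => (coord1 p, coord2 p)).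
  exists (fun xy => of_coords xy.1 xy.2) => [p|[x y]]; first exact: coordsK.
  by have [/= -> ->] := of_coordsK x y.
exists (fun p => (coord1 p, coord2 p)); split=> // x y.
rewrite /latin_graph /net_graph (inj_eq (bij_inj bij)) /=.
by rewrite /axis_op !coordsK eq_coord1 eq_coord2 eq_coord0 orbA orbC.
Qed.

Lemma net_ec3 n : #|[set p | f1 p == f1 o]| = n -> (2 < n)%N ->
  n_ec net_graph 3 -> n = 8 /\ graph_iso net_graph LSgraph.
Proof.
move=> cn n2 ec; have cQ : #|{: axis}| = n by rewrite card_sig -cn cardsE.
have iso := net_latin_iso.
have [|c8 iso'] := @loop_Z23_iso _ _ _ axis_id_r axis_id_l axis_opI axis_Iop (n_ec_iso iso ec).
  by rewrite cQ.
by split; [rewrite -cQ | apply: graph_iso_trans iso (graph_iso_sym iso')].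
Qed.
End Net.

(** * Parallel classes of a pg(s,2,2) *)

Section Parallelism.
Variables (P L : finType) (I : P -> L -> bool) (s : nat).
Hypothesis pg : partial_geometry I s 2 2.

Definition meets (l m : L) := [exists y, I y m && I y l].

Definition par (l m : L) := (l == m) || ~~ meets l m.

Lemma par_sym l m : par l m = par m l.
Proof.
by rewrite /par eq_sym /meets; congr (_ || ~~ _); apply: eq_existsb => y; rewrite andbC.
Qed.

(** Playfair's axiom: off [l], two of the three lines through [x] meet [l], leaving one; on [l],
    only [l] itself qualifies. *)
Lemma par_through x l : #|[set m | I x m && par l m]| = 1%N.
Proof.
have [_ _ c3 c2] := pg; have [xl|xl] := boolP (I x l).
  rewrite -(cards1 l); apply: eq_card => m; rewrite !inE /par.
  have [<-|lm] /= := eqVneq l m; first by rewrite xl.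
  by apply/negP=> /andP[xm /existsP[]]; exists x; rewrite xm xl.
have := c3 x; rewrite -(cardsID [set m | meets l m]) (_ : _ :&: _ =
    [set m | I x m && [exists y, I y m && I y l]]); last by apply/setP=> m; rewrite !inE.
rewrite (c2 _ _ xl) => /(@addnI 2 _ 1%N) <-; apply: eq_card => m; rewrite !inE /par.
by case: eqVneq => [<-|_] /=; rewrite ?(negPf xl) ?andbF // andbC.
Qed.

Lemma par_uniq x l m m' : I x m -> I x m' -> par l m -> par l m' -> m = m'.
Proof.
move=> xm xm' lm lm'; have /eqP/cards1P[k E] := par_through x l.
have: m \in [set k] by rewrite -E inE xm.
have: m' \in [set k] by rewrite -E inE xm'.
by rewrite !inE => /eqP-> /eqP->.
Qed.

(** If [l] and [k] shared a point, both would be the parallel to [m] through it. *)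
Lemma par_trans l m k : par l m -> par m k -> par l k.
Proof.
rewrite par_sym => ml mk; apply/orP; have [//|lk] := eqVneq l k; first by left.
right; apply: contra lk => /existsP[y /andP[yk yl]].
by rewrite (par_uniq yl yk ml mk).
Qed.

Definition parline (l : L) (x : P) : L :=
  odflt l [pick m | I x m && par l m].

Lemma parlineP l x : I x (parline l x) /\ par l (parline l x).
Proof.
rewrite /parline; case: pickP => [m /andP[] //|E].
have /eqP/cards1P[k] := par_through x l.
by move/setP/(_ k); rewrite !inE E eqxx.
Qed.

Lemma parline_eq l x m : I x m -> par l m -> parline l x = m.
Proof. by move=> xm lm; have [h k] := parlineP l x; apply: (par_uniq h xm k lm). Qed.

Lemma par_point x l m : I x l -> I x m -> par l m -> l = m.
Proof.
by move=> xl xm /orP[/eqP //|/existsP[]]; exists x; rewrite xl xm.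
Qed.

(** No line is parallel to both [l] and [m], as these meet in [o]. Two points with the same pair of
    lines, or a pair of lines without intersection, would produce such a line. *)
Lemma parline_net o l m : I o l -> I o m -> l != m ->
  net_pair (parline l) (parline m).
Proof.
move=> ol om lm; have npar k : par l k -> par m k -> False.
  move=> lk mk; have := par_trans lk (_ : par k m); rewrite par_sym => /(_ mk).
  by move=> /(par_point ol om) E; rewrite E eqxx in lm.
split=> p q.
  have [pl lp] := parlineP l p; have [pm mp] := parlineP m p.
  have [ql lq] := parlineP l q; have [qm mq] := parlineP m q.
  move=> El Em; apply/eqP/idPn=> pq; have [u _ _ _] := pg.
  have /card_le1_eqP h := u p q pq.
  have E : parline l p = parline m p.
    by apply: h; rewrite inE ?pl ?pm /= ?El ?Em.
  by apply: (npar (parline l p)) => //; rewrite E.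
have [pl lp] := parlineP l p; have [qm mq] := parlineP m q.
have [/existsP[r /andP[rm rl]]|nm] := boolP (meets (parline l p) (parline m q)).
  by exists r; split; apply: parline_eq.
case: (npar (parline m q)) => //; apply: par_trans lp _.
by rewrite /par nm orbT.
Qed.

Lemma pg_ec3 : (2 <= s)%N -> (0 < #|P|)%N -> n_ec (point_graph I) 3 ->
  s = 7 /\ graph_iso (point_graph I) LSgraph.
Proof.
move=> s2 /card_gt0P[o _] ec; have [_ cl c3 c2] := pg.
have [l0 [l1 [l2 [l01 l02 l12 El]]]] := card3_set (c3 o).
have ol k : I o k = [|| k == l0, k == l1 | k == l2].
  by move/setP: El => /(_ k); rewrite !inE orbA.
have [o0 o1 o2] : [/\ I o l0, I o l1 & I o l2] by rewrite !ol !eqxx !orbT.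
have graphE : point_graph I =2 net_graph (parline l0) (parline l1) (parline l2).
  move=> x y; congr andb; apply/existsP/or3P.
    move=> [l /andP[xl yl]].
    (* The three lines through [o] represent all parallel classes. *)
    have [k [ok lk]] : exists k, I o k /\ par k l.
      by exists (parline l o); rewrite par_sym; exact: parlineP.
    have E : parline k x == parline k y.
      by rewrite (parline_eq xl lk) (parline_eq yl lk).
    move: ok; rewrite ol => /or3P[]/eqP Ek; rewrite Ek in E;
      by [constructor 1|constructor 2|constructor 3].
  by case=> /eqP E; [exists (parline l0 x)|exists (parline l1 x)|exists (parline l2 x)];
    rewrite {2}E ?(proj1 (parlineP _ _)).
have iso : graph_iso (point_graph I) (net_graph (parline l0) (parline l1) (parline l2)).
  by exists id; split; [exists id | move=> x y; rewrite graphE].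
(* The axis is the point set of [l1], so the loop has order [s.+1], which exceeds 2. *)
have [||s8 iso'] := net_ec3 (parline_net o0 o1 l01) (parline_net o1 o2 l12)
  (parline_net o0 o2 l02) (o := o) (n := s.+1) _ _ (n_ec_iso iso ec).
- rewrite -(cl l1); apply: eq_card => p; rewrite !inE.
  have parxx l : par l l by rewrite /par eqxx.
  rewrite (parline_eq o1 (parxx _)); apply/eqP/idP => [<-|pl].
    by have [] := parlineP l1 p.
  exact: parline_eq.
- by [].
by split; [case: s8 | apply: graph_iso_trans iso iso'].
Qed.
End Parallelism.

Local Close Scope ring_scope.

Theorem mainTheorem9 :
  (exists (P L : finType) (I : P -> L -> bool),
     [/\ partial_geometry I 7 2 2, n_ec (point_graph I) 3 &
         graph_iso (point_graph I) LSgraph]) /\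
  (forall (P L : finType) (I : P -> L -> bool) (s : nat),
     (2 <= s)%N -> (0 < #|P|)%N ->
     partial_geometry I s 2 2 -> n_ec (point_graph I) 3 ->
     s = 7%N /\ graph_iso (point_graph I) LSgraph).
Proof.
split; last by move=> P L I s s2 P0 pg ec; exact: (pg_ec3 pg).
have iso : graph_iso (point_graph (@cayley_inc Z23)) LSgraph.
  by exists id; split; [exists id | move=> x y; rewrite cayley_point_graph].
exists (Z23 * Z23)%type, ('I_3 * Z23)%type, (@cayley_inc Z23); split=> //.
- by apply: cayley_partial_geometry; rewrite card_Z23.
- exact: n_ec_iso (graph_iso_sym iso) LSgraph_ec3.
Qed.
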